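(* Let $f(n,k)$ denote the number of Boolean intervals of rank $k$ in the right weak order $W(\mathfrak{S}_n)$. Then $$f(n,k)=\frac{n!}{2^k}\binom{n-k}{k}.$$
   Context: The right weak order $W(\mathfrak{S}_n)$ is the partial order on $\mathfrak{S}_n$ with cover relations $\tau\lessdot\tau s_i$ whenever $\tau(i)<\tau(i+1)$, where $s_i=(i,i+1)$ is a simple transposition. An interval $[v,w]=\{u:v\le u\le w\}$ is a Boolean interval of rank $k$ if it is isomorphic as a poset to the lattice of all subsets of a $k$-element set ordered by inclusion; intervals $[\pi,\pi]$ are Boolean of rank $0$. *)

(* Defs.v *)
From mathcomp Require Import all_boot all_order all_fingroup all_algebra.

Set Implicit Arguments.
Unset Strict Implicit.
Unset Printing Implicit Defensive.

(* The product of mathcomp permutations composes from left to right,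
   [(s * t) x = t (s x)], so the paper's [u s_i], i.e. the map sending [x] to
   [u (s_i x)], is [tperm i j * u] with [j = i + 1]. *)
Definition weak_cover (n : nat) : rel 'S_n := fun u v =>
  [exists i : 'I_n, exists j : 'I_n,
    [&& j == i.+1 :> nat, u i < u j & v == (tperm i j * u)%g]].

Definition weak_le (n : nat) : rel 'S_n := connect (@weak_cover n).

Definition weak_interval (n : nat) (v w : 'S_n) : {set 'S_n} :=
  [set u | weak_le v u && weak_le u w].

Definition boolean_of_rank (n k : nat) (I : {set 'S_n}) : bool :=
  [exists f : {ffun {set 'I_k} -> 'S_n},
    [&& injectiveb f, f @: [set: {set 'I_k}] == I &
      [forall A : {set 'I_k}, forall B : {set 'I_k},
        (A \subset B) == weak_le (f A) (f B)]]].

Definition boolean_intervals (n k : nat) : {set {set 'S_n}} :=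
  [set I : {set 'S_n} |
    [exists v : 'S_n, exists w : 'S_n, weak_le v w && (I == weak_interval v w)]
    && boolean_of_rank k I].

(* Main.v *)
(** The weak order is inclusion of inversion sets.  The atoms of a Boolean
    interval [v, w] are the [v s_i] for [i] in a set [J] of ascents of [v]; two
    neighbours [i], [i + 1] cannot both lie in [J], since their join has three
    more inversions than [v] but sits at rank 2.  Hence [w] adds exactly the pairs
    [(v i, v (i+1))], [i] in [J], to the inversions of [v], and conversely every
    set [J] of pairwise non-adjacent ascents of [v] arises.  There are
    C(n - k, k) non-adjacent [J] of size [k], and composing with each [s_i],
    [i] in [J], halves the number of candidates for [v], leaving n!/2^k. *)
Require Import Defs.
From mathcomp Require Import all_boot all_order all_fingroup all_algebra.
From mathcomp Require Import zify.

Set Implicit Arguments.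
Unset Strict Implicit.
Unset Printing Implicit Defensive.

(** * Counting sets without two consecutive elements *)

Definition sparse (N : nat) (J : {set 'I_N}) :=
  [forall i in J, forall j in J, i.+1 != j :> nat].

Lemma sparseP (N : nat) (J : {set 'I_N}) :
  reflect (forall i j, i \in J -> j \in J -> i.+1 <> j :> nat) (sparse J).
Proof.
apply: (iffP forall_inP) => [h i j iJ jJ|h i iJ].
  by apply/eqP; move/forall_inP: (h i iJ); apply.
by apply/forall_inP=> j jJ; apply/eqP; apply: h.
Qed.

Lemma sparse_sub (N : nat) (J J' : {set 'I_N}) : J \subset J' -> sparse J' -> sparse J.
Proof.
move=> /subsetP s /sparseP h; apply/sparseP=> i j /s iJ /s jJ; exact: h.
Qed.

(** Pascal's rule, splitting on whether the largest allowed index lies in [J]. The bound [m] varies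
    while the type ['I_N] stays fixed, so the induction never moves sets between ordinal types. *)
Lemma card_sparse_bounded (N m k : nat) : m <= N ->
  #|[set J : {set 'I_N} |
      [&& J \subset [set i : 'I_N | i < m], sparse J & #|J| == k]]| =
  'C(m.+1 - k, k).
Proof.
have [p] := ubnP m; elim: p m k => // p IH m [|k] lemp mN.
  rewrite bin0; transitivity #|[set set0 : {set 'I_N}]|; last by rewrite cards1.
  apply: eq_card => J; rewrite !inE cards_eq0.
  case: eqVneq => [->|_]; rewrite ?andbF // sub0set /= andbT.
  by apply/sparseP=> i j; rewrite inE.
case: m => [|m] in lemp mN *.
  rewrite bin_small ?subSS ?sub0n //; apply/eqP; rewrite cards_eq0 -subset0.
  apply/subsetP=> J; rewrite inE => /and3P[s _ cJ].
  suff J0 : J = set0 by rewrite J0 cards0 in cJ.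
  by apply/setP=> i; rewrite inE; apply/negP=> /(subsetP s); rewrite inE.
pose x := Ordinal mN.
rewrite -(cardsID [set J : {set 'I_N} | x \in J]).
rewrite (_ : #|_ :\: _| = 'C(m.+1 - k.+1, k.+1)); last first.
  rewrite -(IH m) ?(ltnW mN) //; apply: eq_card => J; rewrite !inE andbA; congr (_ && _).
  apply/andP/subsetP => [[xJ /subsetP s] i iJ|s].
    have := s i iJ; rewrite !inE ltnS leq_eqVlt => /orP[/eqP e|//].
    by move: xJ; rewrite (_ : x = i) ?iJ //; apply: val_inj.
  split; first by apply/negP=> /s; rewrite inE ltnn.
  by apply/subsetP=> i /s; rewrite !inE; apply: ltnW.
have notx (J : {set 'I_N}) : J \subset [set i : 'I_N | i < m.-1] -> x \notin J.
  by move=> s; apply/negP => /(subsetP s); rewrite inE /=; lia.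
(* If [x] is in [J], the index just below [x] is not, so [J :\ x] lies below [m.-1]. For [m = 0] the
   truncation is right: [J :\ x] is then empty. *)
rewrite (_ : #|_ :&: _| = 'C(m.-1.+1 - k, k)); last first.
  rewrite -(IH m.-1); [|lia|lia].
  rewrite -[RHS](@card_in_imset _ _ (fun J => x |: J)); last first.
    move=> J J'; rewrite !inE => /and3P[/notx xJ _ _] /and3P[/notx xJ' _ _] e.
    by rewrite -(setU1K xJ) -(setU1K xJ') e.
  apply: eq_card => J; apply/idP/imsetP => [|[K + ->]]; last first.
    rewrite !inE => /and3P[s /sparseP sp /eqP cK]; rewrite eqxx /= andbT.
    rewrite cardsU1 (notx _ s) cK add1n eqxx andbT subUset sub1set inE /= ltnSn /=.
    apply/andP; split.
      by apply: subset_trans s _; apply/subsetP=> i; rewrite !inE; lia.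
    apply/sparseP=> i j; rewrite !in_setU1 => /orP[/eqP ->|iK] /orP[/eqP ->|jK] /=.
    - lia.
    - by have := subsetP s j jK; rewrite inE; lia.
    - by have := subsetP s i iK; rewrite inE; lia.
    - exact: sp.
  rewrite !inE => /andP[/and3P[s sp cJ] xJ]; exists (J :\ x); last by rewrite setD1K.
  rewrite inE (sparse_sub (subsetDl _ _) sp) /=; apply/andP; split; last first.
    by rewrite (cardsD1 x) xJ in cJ.
  apply/subsetP=> i; rewrite in_setD1 inE => /andP[neq iJ].
  have := subsetP s i iJ; rewrite inE => li.
  have := sparseP _ sp i x iJ xJ; move: neq; rewrite -val_eqE /=; lia.
move=> {IH notx}; case: m {lemp mN} x => [|m] _ /=.
  by case: k => //= k; rewrite !bin_small //; lia.
have [km|km] := leqP k m.+1; last by rewrite !bin_small //; lia.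
have -> : m.+3 - k.+1 = (m.+1 - k).+1 by lia.
by rewrite binS addnC subSS.
Qed.

Lemma card_sparse (n k : nat) :
  #|[set J : {set 'I_n.-1} | sparse J && (#|J| == k)]| = 'C(n - k, k).
Proof.
transitivity 'C(n.-1.+1 - k, k).
  rewrite -(@card_sparse_bounded n.-1 n.-1) //; apply: eq_card => J; rewrite !inE.
  by rewrite (_ : J \subset _) //; apply/subsetP=> i _; rewrite inE.
(* For [n = 0] the number [n.-1.+1] is 1 instead of 0, yet both binomials are 1 at [k = 0] and
   vanish for positive [k]. *)
by case: n => [|//]; case: k => // k; rewrite !bin_small //; lia.
Qed.

(** * Inversion sets and the right weak order *)

Section Inversions.

Variable n : nat.
Implicit Types (u v w s : 'S_n) (i j : 'I_n.-1) (J : {set 'I_n.-1}).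

(** The simple transpositions are indexed by ['I_n.-1], so that every index has both of its
    positions in ['I_n]; for [n = 0] there are none. *)
Definition lo i : 'I_n := widen_ord (leq_pred n) i.

Lemma hi_subproof i : i.+1 < n.
Proof. by rewrite -ltn_predRL. Qed.

Definition hi i : 'I_n := Ordinal (hi_subproof i).

Lemma lo_inj : injective lo.
Proof. by move=> i j /(congr1 val) /= /val_inj. Qed.

Lemma lo_neq_hi i : lo i != hi i.
Proof. by rewrite -val_eqE /=; lia. Qed.

Definition swap v i : 'S_n := (tperm (lo i) (hi i) * v)%g.

Definition asc v : {set 'I_n.-1} := [set i | v (lo i) < v (hi i)].

(* Inversions are recorded by values, not positions: this is what makes the
   right weak order an inclusion order. *)
Definition invset v : {set 'I_n * 'I_n} :=
  [set p : 'I_n * 'I_n | (p.1 < p.2) && (v^-1%g p.2 < v^-1%g p.1)].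

Definition adj v i : 'I_n * 'I_n := (v (lo i), v (hi i)).

Lemma mem_invset v a b : ((v a, v b) \in invset v) = (v a < v b) && (b < a).
Proof. by rewrite inE /= !permK. Qed.

Lemma swapE v i a : swap v i a = v (tperm (lo i) (hi i) a).
Proof. by rewrite permM. Qed.

Lemma swapK i : involutive (swap^~ i).
Proof. by move=> v; rewrite /swap mulgA tperm2 mul1g. Qed.

Lemma adj_inj v : injective (adj v).
Proof. by move=> i j [/perm_inj/lo_inj]. Qed.

Lemma asc_neg v i : (i \notin asc v) = (v (hi i) < v (lo i)).
Proof.
rewrite inE -leqNgt leq_eqVlt; case: eqVneq => //= /val_inj/perm_inj e.
by move: (lo_neq_hi i); rewrite e eqxx.
Qed.

Lemma adj_notin_invset v i : adj v i \notin invset v.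
Proof. by rewrite mem_invset /=; lia. Qed.

(** Exchanging the contents of two neighbouring positions changes the relative order of no other
    pair of values. *)
Lemma invset_swap v i : i \in asc v -> invset (swap v i) = adj v i |: invset v.
Proof.
rewrite inE => hi_asc; apply/setP=> -[x y].
rewrite -(permKV v x) -(permKV v y); move: (v^-1%g x) (v^-1%g y) => a b {x y}.
rewrite in_setU1 mem_invset xpair_eqE !(inj_eq perm_inj).
(* Both values are now images of positions [a] and [b] under [v]; their positions in [swap v i] are
   the images of [a] and [b] under the transposition. *)
have e c : v c = swap v i (tperm (lo i) (hi i) c).
  by rewrite swapE tpermK.
rewrite [in LHS](e a) [in LHS](e b) mem_invset -!e.
move: (hi_subproof i) hi_asc; case: tpermP => [->|->|/eqP + /eqP +];
  by case: tpermP => [->|->|/eqP + /eqP +]; rewrite -?val_eqE /=; lia.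
Qed.

Lemma weak_coverP u v :
  reflect (exists2 i, i \in asc u & v = swap u i) (weak_cover u v).
Proof.
apply: (iffP existsP) => [[a /existsP[b /and3P[/eqP e l /eqP ->]]]|[i ia ->]].
  have ha : a < n.-1 by rewrite ltn_predRL -e.
  have ea : lo (Ordinal ha) = a by apply: val_inj.
  have eb : hi (Ordinal ha) = b by apply: val_inj; rewrite /= e.
  by exists (Ordinal ha); rewrite ?inE /swap ea eb.
exists (lo i); apply/existsP; exists (hi i); rewrite /= eqxx.
by rewrite inE in ia; rewrite ia /=.
Qed.

(** An increasing permutation satisfies [a <= s a]; its inverse is increasing too, which gives the
    opposite inequality. *)
Lemma perm_increasing_eq1 s : (forall i, s (lo i) < s (hi i)) -> s = 1%g.
Proof.
move=> hs.
have inc (a b : 'I_n) : a < b -> s a < s b.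
  case: b => b hb /=; elim: b hb => // b IH hb hab.
  have hb' : b < n.-1 by rewrite ltn_predRL.
  have := hs (Ordinal hb').
  have -> : hi (Ordinal hb') = Ordinal hb by apply: val_inj.
  move: hab; rewrite ltnS leq_eqVlt => /orP[/eqP e|lt].
    by have -> : lo (Ordinal hb') = a by apply: val_inj.
  apply: ltn_trans; have -> : lo (Ordinal hb') = Ordinal (ltnW hb) by apply: val_inj.
  exact: IH.
have incV (a b : 'I_n) : a < b -> s^-1%g a < s^-1%g b.
  move=> hab; rewrite ltnNge leq_eqVlt; apply/negP=> /orP[/eqP/val_inj/perm_inj e|/inc].
    by move: hab; rewrite e ltnn.
  by rewrite !permKV; lia.
have ge (t : 'S_n) : (forall a b : 'I_n, a < b -> t a < t b) -> forall a : 'I_n, a <= t a.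
  move=> ht [a ha]; elim: a ha => // a IH ha /=.
  have ha' : a < n by lia.
  apply: leq_ltn_trans (IH ha') _; exact: ht.
apply/permP=> a; rewrite perm1; apply/val_inj/eqP; rewrite eqn_leq ge // andbT.
by have := ge _ incV (s a); rewrite permK.
Qed.

(** If [w] inverted no pair [adj u i] at an ascent [i] of [u], then [u * w^-1] would increase at
    every index: at ascents of [u] by this assumption, at descents because [w] has all inversions of
    [u]. It would then be the identity. *)
Lemma invset_sub_step u w : invset u \subset invset w -> u != w ->
  exists2 i, i \in asc u & adj u i \in invset w.
Proof.
move=> suw neq; suff /existsP[i /andP[]] : [exists i, (i \in asc u) && (adj u i \in invset w)].
  by exists i.
apply: contraNT neq => /existsPn hno; rewrite -(inj_eq (mulIg w^-1%g)) mulgV.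
apply/eqP/perm_increasing_eq1 => i; rewrite !permM.
have [ia|] := boolP (i \in asc u).
  have := hno i; rewrite ia /= inE /=; rewrite inE in ia; rewrite ia /= -leqNgt leq_eqVlt.
  case/orP=> // /eqP/val_inj/perm_inj/perm_inj e.
  by move: (lo_neq_hi i); rewrite e eqxx.
rewrite asc_neg => id.
have : (u (hi i), u (lo i)) \in invset w by apply: (subsetP suw); rewrite mem_invset id /=.
by rewrite inE => /andP[].
Qed.

Lemma invset_inj : injective invset.
Proof.
move=> u w e; apply/eqP/negPn/negP => /(invset_sub_step _)[|i _]; first by rewrite e.
by rewrite -e (negPf (adj_notin_invset _ _)).
Qed.

(** A cover adds one inversion, so chains enlarge the inversion set. Conversely, [invset_sub_step]
    gives a cover of [u] still below [w], and the number of missing inversions drops. *)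
Lemma weak_leE u w : weak_le u w = (invset u \subset invset w).
Proof.
apply/idP/idP.
  case/connectP=> p; elim: p u => [|x p IH] u /=; first by move=> _ ->.
  case/andP=> /weak_coverP[i ia ->] /IH{}IH /IH; apply: subset_trans.
  by rewrite invset_swap // subsetUr.
have [m] := ubnP #|invset w :\: invset u|; elim: m u => // m IH u lem suw.
have [->|neq] := eqVneq u w; first exact: connect0.
have [i ia iw] := invset_sub_step suw neq.
apply: (@connect_trans _ _ (swap u i)).
  by apply/connect1/weak_coverP; exists i.
apply: IH; last by rewrite invset_swap // subUset sub1set iw.
rewrite -ltnS; apply: leq_trans lem; rewrite ltnS; apply: proper_card.
rewrite invset_swap //; apply/properP; split.
  by apply: setDS; apply: subsetUr.
exists (adj u i); first by rewrite inE adj_notin_invset iw.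
by rewrite in_setD in_setU1 eqxx.
Qed.

(** * Swaps at non-adjacent positions *)

Lemma adj_swap v i j : i <> j -> i.+1 <> j -> j.+1 <> i ->
  adj (swap v i) j = adj v j.
Proof.
move=> ij ij1 ji1; have ijn : i <> j :> nat by move=> /val_inj.
by rewrite /adj !swapE !tpermD // -val_eqE /=; lia.
Qed.

Lemma mem_asc v i : (i \in asc v) = ((adj v i).1 < (adj v i).2).
Proof. by rewrite inE. Qed.

Lemma mem_asc_swap v i : (i \in asc (swap v i)) = (i \notin asc v).
Proof. by rewrite asc_neg inE !swapE tpermL tpermR. Qed.

(** Sparseness enters here: the two positions moved by the swap at [i] are disjoint from those of
    every [j] in [J], so swaps within a sparse set do not disturb each other. *)
Lemma adj_swap_sparse v i J j : sparse (i |: J) -> i \notin J -> j \in J ->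
  adj (swap v i) j = adj v j.
Proof.
move=> /sparseP h iJ jJ.
have iU : i \in i |: J by rewrite setU11.
have jU : j \in i |: J by rewrite setU1r.
by apply: adj_swap; [move=> e; rewrite e jJ in iJ|exact: h|exact: h].
Qed.

Lemma sub_asc_swap v i J : sparse (i |: J) -> i \notin J ->
  (J \subset asc (swap v i)) = (J \subset asc v).
Proof.
move=> h iJ; apply/subsetP/subsetP => s j jJ.
  by have := s j jJ; rewrite !mem_asc (adj_swap_sparse _ h).
by have := s j jJ; rewrite !mem_asc (adj_swap_sparse _ h).
Qed.

(** Performing the swaps of [J] one after another builds [u]; each leaves the remaining pairs
    adjacent and ascending. This [u] will be the top of the cube. *)
Lemma invset_adj_exists v J : sparse J -> J \subset asc v ->
  exists u, invset u = invset v :|: adj v @: J.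
Proof.
have [m] := ubnP #|J|; elim: m J v => // m IH J v lem sp sa.
have [->|[i iJ]] := set_0Vmem J; first by exists v; rewrite imset0 setU0.
have e : i |: J :\ i = J by apply: setD1K.
have ni : i \notin J :\ i by rewrite setD11.
have ia : i \in asc v by apply: (subsetP sa).
case: (IH (J :\ i) (swap v i)).
- by rewrite (cardsD1 i) iJ in lem.
- by apply: sparse_sub sp; apply: subsetDl.
- by rewrite sub_asc_swap ?e //; apply: subset_trans sa; apply: subsetDl.
move=> u eu; exists u; rewrite eu invset_swap // -[in RHS]e imsetU1.
have -> : adj (swap v i) @: (J :\ i) = adj v @: (J :\ i).
  by apply: eq_in_imset => j jJ; apply: (@adj_swap_sparse v i (J :\ i)); rewrite ?e.
by rewrite setUCA setUA.
Qed.

(** The involution [swap^~ i] exchanges the permutations ascending at [i] with those descending at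
    [i], and keeps the ascents in [J]. *)
Lemma card_asc_superset_halve i J : sparse (i |: J) -> i \notin J ->
  #|[set v | J \subset asc v]| = 2 * #|[set v | i |: J \subset asc v]|.
Proof.
move=> sp iJ; rewrite -(cardsID [set v | i \in asc v]) mul2n -addnn.
have -> : [set v | J \subset asc v] :&: [set v | i \in asc v] =
    [set v | i |: J \subset asc v].
  by apply/setP=> v; rewrite !in_setI !in_set subUset sub1set !in_set andbC.
congr (_ + _); rewrite -[RHS](card_imset _ (inv_inj (swapK i))).
apply: eq_card => v; rewrite -[v in RHS](swapK i) (mem_imset _ _ (inv_inj (swapK i))).
by rewrite !in_set subUset sub1set mem_asc_swap sub_asc_swap // in_set andbC.
Qed.

Lemma card_asc_superset J : sparse J -> #|[set v | J \subset asc v]| * 2 ^ #|J| = n`!.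
Proof.
have [m] := ubnP #|J|; elim: m J => // m IH J lem sp.
have [->|[i iJ]] := set_0Vmem J.
  rewrite cards0 muln1 -[RHS](card_Sn n); apply: eq_card => v.
  by rewrite !inE sub0set.
have e : i |: J :\ i = J by apply: setD1K.
have ni : i \notin J :\ i by rewrite setD11.
have c : #|J| = #|J :\ i|.+1 by rewrite (cardsD1 i) iJ.
rewrite c expnS mulnA [_ * 2]mulnC -[in X in X * _]e -card_asc_superset_halve ?e //.
apply: IH; first by rewrite -ltnS -c.
by apply: sparse_sub sp; apply: subsetDl.
Qed.

(** * Cubes spanned by a sparse set of ascents *)

Definition cube J v : {set 'S_n} :=
  [set u | (invset v \subset invset u) && (invset u \subset invset v :|: adj v @: J)].

Lemma adj_sub v (A : {set 'I_n.-1}) J : (adj v @: A \subset invset v :|: adj v @: J) = (A \subset J).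
Proof.
apply/idP/idP => [s|s]; last by apply: subset_trans (imsetS _ s) (subsetUr _ _).
apply/subsetP=> i iA; have := subsetP s _ (imset_f (adj v) iA).
by rewrite in_setU (negPf (adj_notin_invset _ _)) (mem_imset _ _ (@adj_inj v)).
Qed.

Lemma cube_eq_invset_sub J J' v v' :
  cube J v = cube J' v' -> invset v' \subset invset v.
Proof.
move=> e; have : v \in cube J v by rewrite inE subxx subsetUl.
by rewrite e inE => /andP[].
Qed.

(** The cube determines [v] as its least element. Then [J] is recovered by testing the top of each
    cube for membership in the other. *)
Lemma cube_inj J J' v v' :
  sparse J -> J \subset asc v -> sparse J' -> J' \subset asc v' ->
  cube J v = cube J' v' -> (J, v) = (J', v').
Proof.
move=> sp sa sp' sa' e.
have ev : v = v'.
  by apply/invset_inj/eqP; rewrite eqEsubset (cube_eq_invset_sub (esym e)) (cube_eq_invset_sub e).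
rewrite -{v'}ev in sa' e *.
have sub K K' : sparse K -> K \subset asc v -> cube K v = cube K' v -> K \subset K'.
  move=> spK saK eK; have [u eu] := invset_adj_exists spK saK.
  have : u \in cube K v by rewrite inE eu subsetUl subxx.
  by rewrite eK inE eu subUset adj_sub => /andP[_ /andP[]].
suff -> : J = J' by [].
by apply/eqP; rewrite eqEsubset (sub _ _ sp sa e) (sub _ _ sp' sa' (esym e)).
Qed.

(** A subset of [J] corresponds to the permutation that inverts exactly its adjacent pairs in
    addition to the inversions of [v]. *)
Lemma cube_boolean J v : sparse J -> J \subset asc v ->
  cube J v \in boolean_intervals n #|J|.
Proof.
move=> sp sa; rewrite inE; apply/andP; split.
  have [w ew] := invset_adj_exists sp sa.
  apply/existsP; exists v; apply/existsP; exists w.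
  rewrite weak_leE ew subsetUl /=; apply/eqP/setP=> u.
  by rewrite !inE !weak_leE ew.
(* Enumerating [J] carries subsets of the standard set ['I_#|J|] to subsets of [J]. *)
pose g (A : {set 'I_#|J|}) := enum_val @: A : {set 'I_n.-1}.
have gJ A : g A \subset J by apply/subsetP=> _ /imsetP[x _ ->]; apply: enum_valP.
have gsurj (K : {set 'I_n.-1}) : K \subset J -> exists A, g A = K.
  move=> KJ; exists (enum_val @^-1: K); apply/setP=> i.
  apply/imsetP/idP => [[x + ->]|iK]; first by rewrite inE.
  have iJ := subsetP KJ i iK.
  by exists (enum_rank_in iJ i); rewrite ?inE enum_rankK_in.
have /fin_all_exists[f hf] (A : {set 'I_#|J|}) :
    exists u, invset u = invset v :|: adj v @: g A.
  by apply: invset_adj_exists; [apply: sparse_sub sp|apply: subset_trans sa].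
have gS A B : (g A \subset g B) = (A \subset B).
  apply/idP/idP => [/subsetP s|]; last exact: imsetS.
  apply/subsetP=> x xA; have := s _ (imset_f enum_val xA).
  by rewrite (mem_imset _ _ enum_val_inj).
have fS A B : (invset (f A) \subset invset (f B)) = (A \subset B).
  by rewrite !hf subUset subsetUl adj_sub gS.
apply/existsP; exists (finfun f); apply/and3P; split.
- apply/injectiveP=> A B; rewrite !ffunE => e; apply/eqP.
  by rewrite eqEsubset -!fS e subxx.
- apply/eqP/setP=> u; apply/imsetP/idP => [[A _ ->]|].
    rewrite ffunE inE hf subsetUl subUset subsetUl adj_sub; exact: gJ.
  rewrite inE => /andP[vu uw].
  (* The preimage of [u] collects the indices in [J] whose adjacent pair [u] inverts. *)
  have [A eA] : exists A, g A = [set i in J | adj v i \in invset u].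
    by apply: gsurj; apply/subsetP=> i; rewrite inE => /andP[].
  exists A => //; rewrite ffunE; apply: invset_inj; rewrite hf eA.
  apply/eqP; rewrite eqEsubset subUset vu; apply/andP; split.
    apply/subsetP=> p pu; have := subsetP uw p pu; rewrite !in_setU.
    case/orP=> [->//|/imsetP[i iJ ep]]; apply/orP; right.
    by rewrite ep imset_f // inE iJ -ep.
  by apply/subsetP=> _ /imsetP[i + ->]; rewrite inE => /andP[].
- apply/forallP=> A; apply/forallP=> B.
  by rewrite !ffunE weak_leE fS.
Qed.

(** * Every Boolean interval is such a cube *)

Section BooleanInterval.

Variables (k : nat) (v w : 'S_n) (f : {set 'I_k} -> 'S_n).
Implicit Types A B : {set 'I_k}.
Hypothesis f_inj : injective f.
Hypothesis f_img : forall u,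
  (u \in codom f) = (invset v \subset invset u) && (invset u \subset invset w).
Hypothesis f_sub : forall A B, (invset (f A) \subset invset (f B)) = (A \subset B).

Lemma boolean_bounds A :
  (invset v \subset invset (f A)) && (invset (f A) \subset invset w).
Proof. by rewrite -f_img codom_f. Qed.

Lemma boolean_bottom : f set0 = v.
Proof.
have /andP[v0 vw] := boolean_bounds set0.
have : v \in codom f by rewrite f_img subxx (subset_trans v0 vw).
case/codomP=> A eA; apply: invset_inj; apply/eqP; rewrite eqEsubset v0 andbT.
by rewrite eA f_sub sub0set.
Qed.

Lemma boolean_top : f setT = w.
Proof.
have /andP[v0 vw] := boolean_bounds setT.
have : w \in codom f by rewrite f_img subxx (subset_trans v0 vw).
case/codomP=> A eA; apply: invset_inj; apply/eqP; rewrite eqEsubset vw /=.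
by rewrite eA f_sub subsetT.
Qed.

(** No set lies strictly between [A] and [x |: A]. A first step from [f A] towards [f (x |: A)]
    stays in the interval, hence is some [f C] with [C] between these sets and different from
    [A]. *)
Lemma boolean_cover A x : x \notin A ->
  exists2 i, i \in asc (f A) & f (x |: A) = swap (f A) i.
Proof.
move=> xA; have sub : A \subset x |: A by apply: subsetUr.
have [||i ia ip] := @invset_sub_step (f A) (f (x |: A)); first by rewrite f_sub.
  by rewrite (inj_eq f_inj); apply: contraNneq xA => ->; rewrite setU11.
exists i => //; have es := invset_swap ia.
have ub : invset (swap (f A) i) \subset invset (f (x |: A)).
  by rewrite es subUset sub1set ip f_sub.
have : swap (f A) i \in codom f.
  have /andP[b1 _] := boolean_bounds A; have /andP[_ b2] := boolean_bounds (x |: A).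
  by rewrite f_img (subset_trans ub b2) andbT es (subset_trans b1) ?subsetUr.
case/codomP=> C eC; rewrite eC; congr f; apply/eqP; rewrite eqEsubset andbC.
rewrite -f_sub -eC ub /= subUset sub1set -[X in _ && X]f_sub -eC es subsetUr andbT.
(* Without [x], the set [C] would lie in [A], and [f A] would already invert the pair at its own
   ascent [i]. *)
apply: contraT => xC; have : C \subset A.
  apply/subsetP=> y yC; have : y \in x |: A.
    by have /subsetP := ub; rewrite eC; move/subsetP; rewrite f_sub => /subsetP; apply.
  by rewrite in_setU1 => /orP[/eqP e|//]; rewrite -e yC in xC.
rewrite -f_sub -eC es => /subsetP/(_ (adj (f A) i)).
by rewrite in_setU1 eqxx => /(_ isT); rewrite (negPf (adj_notin_invset _ _)).
Qed.

(** Inserting an element is a cover, which adds exactly one inversion: rank in the interval is the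
    excess of inversions over [v]. *)
Lemma card_boolean_invset A : #|invset (f A)| = #|invset v| + #|A|.
Proof.
have [m] := ubnP #|A|; elim: m A => // m IH A lem.
have [->|[x xA]] := set_0Vmem A; first by rewrite boolean_bottom cards0 addn0.
have xD : x \notin A :\ x by rewrite setD11.
have cA : #|A| = #|A :\ x|.+1 by rewrite (cardsD1 x) xA.
rewrite -{1}(setD1K xA); have [i ia ->] := boolean_cover xD.
by rewrite invset_swap // cardsU1 adj_notin_invset IH ?cA ?addnS // -ltnS -cA.
Qed.

(** The atoms [f [set x]] supply the ascents forming [J]. The top [w] inverts all their pairs, and
    [card_boolean_invset] shows that it has only [k] inversions more than [v], so there are no
    others. *)
Lemma boolean_cube : exists2 J : {set 'I_n.-1},
  [&& #|J| == k, sparse J & J \subset asc v] & invset w = invset v :|: adj v @: J.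
Proof.
have /fin_all_exists[j hj] (x : 'I_k) :
    exists i, (i \in asc v) /\ f [set x] = swap v i.
  case: (@boolean_cover set0 x); first by rewrite inE.
  by move=> i; rewrite setU0 boolean_bottom => ia e; exists i.
have j_asc x : j x \in asc v by case: (hj x).
have j_inj : injective j.
  move=> x y e; have /f_inj : f [set x] = f [set y].
    by case: (hj x) => _ ->; case: (hj y) => _ ->; rewrite e.
  by move/set1_inj.
have inv_j x : invset (f [set x]) = adj v (j x) |: invset v.
  by case: (hj x) => ? ->; apply: invset_swap.
have adjA x (A : {set 'I_k}) : x \in A -> adj v (j x) \in invset (f A).
  move=> xA; apply: (subsetP (_ : invset (f [set x]) \subset _)).
    by rewrite f_sub sub1set.
  by rewrite inv_j setU11.
have cJ : #|j @: setT| = k by rewrite card_imset // cardsT card_ord.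
exists (j @: setT); last first.
  apply/eqP; rewrite eq_sym eqEcard; apply/andP; split.
    rewrite subUset; apply/andP; split.
      by rewrite -boolean_top; case/andP: (boolean_bounds setT).
    apply/subsetP=> _ /imsetP[_ /imsetP[x _ ->] ->].
    by rewrite -boolean_top adjA.
  rewrite -boolean_top card_boolean_invset cardsT card_ord cardsU.
  rewrite [X in _ - X](_ : _ = 0) ?subn0 ?(card_imset _ (@adj_inj v)) ?cJ //.
  apply/eqP; rewrite cards_eq0 -subset0; apply/subsetP=> p; rewrite in_setI.
  by case/andP=> + /imsetP[i _ ep]; rewrite ep (negPf (adj_notin_invset _ _)).
rewrite cJ eqxx /=; apply/andP; split; last first.
  by apply/subsetP=> _ /imsetP[x _ ->].
apply/sparseP=> _ _ /imsetP[x _ ->] /imsetP[y _ ->] e.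
(* The inversions (a,b) and (b,c) force (a,c): three new ones at rank 2. *)
have neq : x != y by apply/eqP=> exy; rewrite exy in e; lia.
pose a := lo (j x); pose b := hi (j x); pose c := hi (j y).
have eb : b = lo (j y) by apply: val_inj.
have ab : v a < v b by have := j_asc x; rewrite inE.
have bc : v b < v c by have := j_asc y; rewrite inE -eb.
have lab : a < b by rewrite /=.
have lbc : b < c by rewrite eb /=.
have i1 : (v a, v b) \in invset (f [set x; y]) by apply: (adjA x); rewrite set21.
have i2 : (v b, v c) \in invset (f [set x; y]).
  by rewrite eb; apply: (adjA y); rewrite set22.
have i3 : (v a, v c) \in invset (f [set x; y]).
  by move: i1 i2; rewrite !inE /=; lia.
have : #|(v a, v c) |: ((v b, v c) |: ((v a, v b) |: invset v))| <= #|invset (f [set x; y])|.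
  apply: subset_leq_card; rewrite !subUset !sub1set i1 i2 i3 /=.
  by case/andP: (boolean_bounds [set x; y]).
have [nba ncb] : (b == a) = false /\ (c == b) = false.
  by rewrite -!val_eqE !gtn_eqF.
have [lca lcb lba] : [/\ (c < a) = false, (c < b) = false & (b < a) = false].
  by split; lia.
rewrite card_boolean_invset cards2 neq !cardsU1 !in_setU1 !xpair_eqE !(inj_eq perm_inj) !mem_invset.
by rewrite [a == b]eq_sym nba ncb lca lcb lba !andbF /= !add1n addn2 ltnn.
Qed.

End BooleanInterval.

Lemma boolean_intervalP k (I : {set 'S_n}) : I \in boolean_intervals n k ->
  exists2 p : {set 'I_n.-1} * 'S_n,
    [&& #|p.1| == k, sparse p.1 & p.1 \subset asc p.2] & I = cube p.1 p.2.
Proof.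
rewrite inE => /andP[/existsP[v /existsP[w /andP[_ /eqP eI]]]].
case/existsP=> f /and3P[/injectiveP f_inj /eqP fI /forallP f_sub].
have codomE u : (u \in codom f) = (u \in I).
  by rewrite -fI; apply/codomP/imsetP => [[A ->]|[A _ ->]]; exists A; rewrite ?inE.
have [u|A B|J hJ ew] := @boolean_cube k v w f f_inj.
- by rewrite codomE eI inE !weak_leE.
- have := f_sub A; move=> /forallP/(_ B)/eqP ->; by rewrite weak_leE.
by exists (J, v) => //=; rewrite eI; apply/setP=> u; rewrite !inE !weak_leE ew.
Qed.

End Inversions.

(** * Counting the pairs of a permutation and a sparse set of its ascents *)

Lemma card_boolean_intervals (n k : nat) :
  #|boolean_intervals n k| * 2 ^ k = n`! * 'C(n - k, k).
Proof.
pose P (J : {set 'I_n.-1}) := sparse J && (#|J| == k).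
pose D := [set p : {set 'I_n.-1} * 'S_n | P p.1 && (p.1 \subset asc p.2)].
(* The pairs in [D] parametrise the Boolean intervals of rank [k], bijectively by [cube_inj]. *)
have -> : boolean_intervals n k = (fun p => cube p.1 p.2) @: D.
  apply/setP=> I; apply/idP/imsetP.
    case/boolean_intervalP=> p /and3P[/eqP c sp sa] ->; exists p => //.
    by rewrite inE /P c eqxx sp sa.
  case=> -[J v]; rewrite inE /P /= => /andP[/andP[sp /eqP <-] sa] ->.
  exact: cube_boolean.
rewrite card_in_imset; last first.
  move=> [J v] [J' v']; rewrite !inE /P /= => /andP[/andP[sp _] sa] /andP[/andP[sp' _] sa'].
  exact: cube_inj.
have -> : #|D| = \sum_(J | P J) #|[set v | J \subset asc v]|.
  transitivity (\sum_(J | P J) \sum_(v : 'S_n | J \subset asc v) 1).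
    by rewrite pair_big_dep sum1_card; apply: eq_card => p; rewrite !inE.
  by apply: eq_bigr => J _; rewrite sum1_card; apply: eq_card => v; rewrite !inE.
(* The factor [2 ^ k] is moved inside the sum, where it turns each term into [n!] without any
   division. *)
rewrite big_distrl /= (eq_bigr (fun=> n`!)) => [|J /andP[sp /eqP <-]]; last first.
  exact: card_asc_superset.
rewrite sum_nat_const mulnC -card_sparse; congr (_ * _).
by apply: eq_card => J; rewrite inE.
Qed.

Import GRing.Theory.
Local Open Scope ring_scope.

Theorem theorem1p3 (n k : nat) :
  #|boolean_intervals n k|%:R = n`!%:R / 2 ^+ k * 'C(n - k, k)%:R :> rat.
Proof.
have nz : (2 ^+ k : rat) != 0 by rewrite expf_neq0.
apply: (mulIf nz); rewrite mulrAC divfK //.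
by rewrite -natrX -!natrM card_boolean_intervals.
Qed.
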